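(* Consider the complex 3-dimensional commutative Novikov algebras $A_1,\dots,A_{12}$ given by the products listed in the context. For $1\le i,j\le 12$, the algebra $A_j$ lies in $\partial O(A_i)$ if and only if $A_j$ occurs in the following list for $A_i$: \begin{itemize} \item $A_1$: none; \item $A_2$: $A_1, A_5$; \item $A_3$: $A_1, A_2, A_5, A_6, A_7, A_9, A_{10}$; \item $A_4$: $A_1, A_2, A_3, A_5, A_6, A_7, A_8, A_9, A_{10}, A_{11}, A_{12}$; \item $A_5$: $A_1$; \item $A_6$: $A_1, A_2, A_5, A_9, A_{10}$; \item $A_7$: $A_1, A_5, A_9, A_{10}$; \item $A_8$: $A_1, A_2, A_5, A_6, A_7, A_9, A_{10}, A_{11}, A_{12}$; \item $A_9$: $A_1, A_5$; \item $A_{10}$: $A_1, A_5, A_9$; \item $A_{11}$: $A_1, A_5$; \item $A_{12}$: $A_1, A_5, A_9, A_{10}, A_{11}$. \end{itemize}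
   Context: A Novikov algebra over $\mathbb{C}$ is a complex vector space with a bilinear product satisfying $(x\cdot y)\cdot z-x\cdot(y\cdot z)=(y\cdot x)\cdot z-y\cdot(x\cdot z)$ and $(x\cdot y)\cdot z=(x\cdot z)\cdot y$ for all $x,y,z$. Fix a 3-dimensional complex vector space $V$ with basis $(e_1,e_2,e_3)$. The set of Novikov products on $V$, identified with their structure constants in $\mathbb{C}^{27}$, is an affine algebraic set, on which $GL_3(\mathbb{C})$ acts by $(g\circ\mu)(x,y)=g(\mu(g^{-1}x,g^{-1}y))$. For a 3-dimensional Novikov algebra $A$, $O(A)$ is the orbit of a structure representing $A$, $\overline{O(A)}$ its Zariski closure, and $\partial O(A)=\overline{O(A)}\setminus O(A)$; ''$B$ lies in $\partial O(A)$'' means that a structure representing $B$ lies in $\partial O(A)$. The algebras (basis $e_1,e_2,e_3$; products of basis vectors not listed are zero): $A_1$: all products zero. $A_2$: $e_3e_3=e_3$. $A_3$: $e_2e_2=e_2$, $e_3e_3=e_3$. $A_4$: $e_1e_1=e_1$, $e_2e_2=e_2$, $e_3e_3=e_3$. $A_5$: $e_2e_2=e_1$. $A_6$: $e_2e_2=e_1$, $e_3e_3=e_3$. $A_7$: $e_1e_2=e_1$, $e_2e_1=e_1$, $e_2e_2=e_2$. $A_8$: $e_1e_2=e_1$, $e_2e_1=e_1$, $e_2e_2=e_2$, $e_3e_3=e_3$. $A_9$: $e_2e_3=e_1$, $e_3e_2=e_1$. $A_{10}$: $e_2e_3=e_1$, $e_3e_2=e_1$, $e_3e_3=e_2$. $A_{11}$: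 $e_1e_3=e_1$, $e_2e_3=e_2$, $e_3e_1=e_1$, $e_3e_2=e_2$, $e_3e_3=e_3$. $A_{12}$: $e_1e_3=e_1$, $e_2e_2=e_1$, $e_2e_3=e_2$, $e_3e_1=e_1$, $e_3e_2=e_2$, $e_3e_3=e_3$. *)

(* Defs.v *)
From mathcomp Require Import all_boot all_order all_algebra.
From mathcomp Require Import complex mpoly reals.
From mathcomp Require Import ring.

Set Implicit Arguments.
Unset Strict Implicit.
Unset Printing Implicit Defensive.

Import GRing.Theory.
Local Open Scope ring_scope.

(* The complex numbers are [R[i]] for a real type [R]; everything that does    *)
(* not depend on this is stated over an arbitrary field.                       *)
Section Structures.
Variable K : fieldType.

Let V := 'cV[K]_3.

(* The basis is [e 0, e 1, e 2] here, written e_1, e_2, e_3 informally.        *)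
Definition basis_vec (i : 'I_3) : V := delta_mx i 0.

(* A point [c] of K^27: [c (i, j, k)] is the [k]-th coordinate of e_i e_j.     *)
Definition structure := {ffun 'I_3 * 'I_3 * 'I_3 -> K}.

Definition mul (c : structure) (x y : V) : V :=
  \sum_(i < 3) \sum_(j < 3)
    (x i 0 * y j 0) *: \sum_(k < 3) c (i, j, k) *: basis_vec k.

Definition constants (m : V -> V -> V) : structure :=
  [ffun p => m (basis_vec p.1.1) (basis_vec p.1.2) p.2 0].

Definition novikov (c : structure) : Prop :=
  (forall x y z : V,
     mul c (mul c x y) z - mul c x (mul c y z) =
     mul c (mul c y x) z - mul c y (mul c x z)) /\
  (forall x y z : V, mul c (mul c x y) z = mul c (mul c x z) y).

Definition commutative_structure (c : structure) : Prop :=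
  forall x y : V, mul c x y = mul c y x.

(* The action of GL_3; only meaningful for [g \in unitmx].                     *)
Definition act (g : 'M[K]_3) (c : structure) : structure :=
  constants (fun x y => g *m mul c (invmx g *m x) (invmx g *m y)).

Definition orbit (c : structure) : structure -> Prop :=
  fun d => exists2 g : 'M[K]_3, g \in unitmx & d = act g c.

(* Zariski closure of [S] in the subspace [X] of the affine space K^I, whose   *)
(* coordinates are numbered by [enum_val : 'I_#|I| -> I].                      *)
Definition zariski_closure_in (I : finType) (X S : {ffun I -> K} -> Prop) :
    {ffun I -> K} -> Prop :=
  fun v => X v /\
    forall p : {mpoly K[#|I|]},
      (forall s, S s -> p.@[fun i => s (enum_val i)] = 0) ->
      p.@[fun i => v (enum_val i)] = 0.

Definition orbit_closure (c : structure) : structure -> Prop :=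
  zariski_closure_in novikov (orbit c).

Definition orbit_boundary (c : structure) : structure -> Prop :=
  fun d => orbit_closure c d /\ ~ orbit c d.

(* A structure on V represents the algebra given by [b] iff it is isomorphic   *)
(* to it, that is, iff it belongs to the orbit of [b].                         *)
Definition lies_in_boundary (b a : structure) : Prop :=
  exists2 d : structure, orbit b d & orbit_boundary a d.

(* The structure in which e_i e_j is the sum of the e_k with (i, j, k) in [s], *)
(* the indices in [s] starting at 1.                                           *)
Definition structure_of (s : seq (nat * nat * nat)) : structure :=
  [ffun p : 'I_3 * 'I_3 * 'I_3 =>
     ((p.1.1.+1, p.1.2.+1, p.2.+1) \in s)%:R].

End Structures.

Definition products (n : nat) : seq (nat * nat * nat) :=
  match n with
  | 2 => [:: (3, 3, 3)]
  | 3 => [:: (2, 2, 2); (3, 3, 3)]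
  | 4 => [:: (1, 1, 1); (2, 2, 2); (3, 3, 3)]
  | 5 => [:: (2, 2, 1)]
  | 6 => [:: (2, 2, 1); (3, 3, 3)]
  | 7 => [:: (1, 2, 1); (2, 1, 1); (2, 2, 2)]
  | 8 => [:: (1, 2, 1); (2, 1, 1); (2, 2, 2); (3, 3, 3)]
  | 9 => [:: (2, 3, 1); (3, 2, 1)]
  | 10 => [:: (2, 3, 1); (3, 2, 1); (3, 3, 2)]
  | 11 => [:: (1, 3, 1); (2, 3, 2); (3, 1, 1); (3, 2, 2); (3, 3, 3)]
  | 12 => [:: (1, 3, 1); (2, 2, 1); (2, 3, 2); (3, 1, 1); (3, 2, 2);
              (3, 3, 3)]
  | _ => [::]
  end%N.

Definition algA (K : fieldType) (n : nat) : structure K :=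
  structure_of K (products n).

Definition boundary_list (n : nat) : seq nat :=
  match n with
  | 2 => [:: 1; 5]
  | 3 => [:: 1; 2; 5; 6; 7; 9; 10]
  | 4 => [:: 1; 2; 3; 5; 6; 7; 8; 9; 10; 11; 12]
  | 5 => [:: 1]
  | 6 => [:: 1; 2; 5; 9; 10]
  | 7 => [:: 1; 5; 9; 10]
  | 8 => [:: 1; 2; 5; 6; 7; 9; 10; 11; 12]
  | 9 => [:: 1; 5]
  | 10 => [:: 1; 5; 9]
  | 11 => [:: 1; 5]
  | 12 => [:: 1; 5; 9; 10; 11]
  | _ => [::]
  end%N.

Section Facts.
Variable K : fieldType.
Implicit Types (c : structure K) (x y z : 'cV[K]_3).

Lemma mulE c x y k :
  mul c x y k 0 = \sum_(i < 3) \sum_(j < 3) x i 0 * y j 0 * c (i, j, k).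
Proof.
rewrite /mul summxE; apply: eq_bigr => i _.
rewrite summxE; apply: eq_bigr => j _.
rewrite mxE summxE (bigD1 k) //= big1 => [|l nlk]; last first.
  by rewrite !mxE eqxx andbT eq_sym (negPf nlk) mulr0.
by rewrite !mxE !eqxx mulr1 addr0.
Qed.

Lemma mul_sum c (I J : finType) (a : I -> K) (b : J -> K) u v :
  mul c (\sum_i a i *: u i) (\sum_j b j *: v j) =
  \sum_i \sum_j (a i * b j) *: mul c (u i) (v j).
Proof.
apply/colP => k; rewrite mulE summxE.
under [RHS]eq_bigr => i _.
  rewrite summxE.
  under eq_bigr => j _ do rewrite mxE mulE mulr_sumr.
  over.
under [RHS]eq_bigr => i _ do rewrite exchange_big.
rewrite [RHS]exchange_big /=; apply: eq_bigr => p _.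
under [RHS]eq_bigr => i _.
  under eq_bigr => j _ do rewrite mulr_sumr.
  rewrite exchange_big; over.
rewrite [RHS]exchange_big /=; apply: eq_bigr => q _.
rewrite !summxE !mulr_suml; apply: eq_bigr => i _.
rewrite mulr_sumr mulr_suml; apply: eq_bigr => j _.
by rewrite !mxE; ring.
Qed.

Lemma col_sum_basis x : x = \sum_i x i 0 *: basis_vec K i.
Proof.
apply/colP => k; rewrite summxE (bigD1 k) //= big1 => [|l nlk].
  by rewrite !mxE !eqxx mulr1 addr0.
by rewrite !mxE eqxx andbT eq_sym (negPf nlk) mulr0.
Qed.

Lemma mul_constants (m : 'cV[K]_3 -> 'cV[K]_3 -> 'cV[K]_3) x y :
  mul (constants m) x y =
  \sum_i \sum_j (x i 0 * y j 0) *: m (basis_vec K i) (basis_vec K j).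
Proof.
apply: eq_bigr => i _; apply: eq_bigr => j _; congr (_ *: _).
rewrite [RHS]col_sum_basis; apply: eq_bigr => k _.
by rewrite ffunE.
Qed.

Lemma mul_act g c x y :
  mul (act g c) x y = g *m mul c (invmx g *m x) (invmx g *m y).
Proof.
have lin u : invmx g *m u = \sum_i u i 0 *: (invmx g *m basis_vec K i).
  rewrite {1}(col_sum_basis u) mulmx_sumr.
  by apply: eq_bigr => i _; rewrite -scalemxAr.
rewrite mul_constants (lin x) (lin y).
rewrite mul_sum mulmx_sumr; apply: eq_bigr => i _.
by rewrite mulmx_sumr; apply: eq_bigr => j _; rewrite -scalemxAr.
Qed.

Lemma novikov_act g c : g \in unitmx -> novikov c -> novikov (act g c).
Proof.
move=> gu [Ha Hr]; split=> x y z; rewrite !mul_act !mulKmx //.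
  by rewrite -!mulmxBr Ha.
by rewrite Hr.
Qed.

Lemma algA_comm n : commutative_structure (algA K n).
Proof.
move=> x y; apply/colP => k; rewrite !mulE exchange_big /=.
apply: eq_bigr => i _; apply: eq_bigr => j _; rewrite [x j 0 * _]mulrC.
congr (_ * _); rewrite !ffunE /=; congr (_ %:R); congr nat_of_bool.
case: i j k => [[|[|[|//]]] ?] [[|[|[|//]]] ?] [[|[|[|//]]] ?];
by do 13?[case: n => [|n] //].
Qed.

Lemma mul_assoc c :
  (forall i j k m, \sum_l c (j, k, l) * c (i, l, m) =
                   \sum_l c (i, j, l) * c (l, k, m)) ->
  associative (mul c).
Proof.
move=> cA x y z; apply/colP => m.
transitivity (\sum_(i < 3) \sum_(j < 3) \sum_(k < 3)
    x i 0 * y j 0 * z k 0 * \sum_l c (j, k, l) * c (i, l, m)).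
  rewrite mulE; apply: eq_bigr => i _.
  under eq_bigr => l _.
    rewrite mulE mulr_sumr mulr_suml.
    under eq_bigr => j _ do rewrite mulr_sumr mulr_suml.
    over.
  rewrite exchange_big; apply: eq_bigr => j _.
  rewrite exchange_big; apply: eq_bigr => k _.
  by rewrite mulr_sumr; apply: eq_bigr => l _; ring.
rewrite mulE [RHS]exchange_big /=.
under [RHS]eq_bigr => k _.
  under eq_bigr => l _.
    rewrite mulE !mulr_suml.
    under eq_bigr => i _ do rewrite !mulr_suml.
    over.
  rewrite exchange_big; over.
rewrite [RHS]exchange_big /=; apply: eq_bigr => i _.
under [RHS]eq_bigr => k _ do rewrite exchange_big.
rewrite [RHS]exchange_big /=; apply: eq_bigr => j _.
apply: eq_bigr => k _; rewrite cA mulr_sumr.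
by apply: eq_bigr => l _; ring.
Qed.

Lemma algA_assoc n : associative (mul (algA K n)).
Proof.
apply: mul_assoc => i j k m.
under eq_bigr => l _ do rewrite !ffunE -natrM /=.
under [RHS]eq_bigr => l _ do rewrite !ffunE -natrM /=.
rewrite -!natr_sum; congr _%:R; rewrite !big_ord_recl !big_ord0.
case: i j k m => [[|[|[|//]]] ?] [[|[|[|//]]] ?] [[|[|[|//]]] ?];
by case=> [[|[|[|//]]] ?]; do 13?[case: n => [|n] //].
Qed.

Lemma algA_novikov n : novikov (algA K n).
Proof.
by split=> x y z; rewrite -!algA_assoc ?subrr // (algA_comm _ y).
Qed.

End Facts.

(* Main.v *)
From mathcomp Require Import all_boot all_order all_algebra.
From mathcomp Require Import complex mpoly reals.
From mathcomp Require Import ring.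
Require Import Defs.

(** Write A -> B when B lies in the orbit closure of A; this is a preorder on
    structures ([orbit_closure_trans]), because the group acts by polynomial
    maps.  It therefore suffices to know enough arrows and enough non-arrows
    between the twelve algebras.

    The arrows are the seventeen pairs of [degenerations].  Each one comes from
    a basis E(t) of the first algebra, polynomial in t and independent for
    t <> 0, in which the structure constants are polynomials in t whose values
    at t = 0 are those of the second algebra.  A polynomial that vanishes on the
    orbit vanishes along this curve for all t <> 0, hence also at t = 0
    ([orbit_closure_of_basis]).  The less obvious bases contain the powers of
    one element x: the ideal (x) of C[x]/(f(x)), where f(0) = 0, degenerates to
    that of C[x]/(x^d) when the roots of f, of degree d, move to 0.

    The non-arrows are the ten pairs of [obstructions].  Each one comes from a
    polynomial identity in the product, the trace of left multiplication and
    linear forms; such an identity is preserved by the group and is closed, so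
    an algebra satisfying it cannot degenerate to one that violates it
    ([covariant_obstruction]).

    These data decide everything: for any two of the twelve algebras, either a
    chain of arrows leads from the first, A, to the second, B, or there is an
    obstruction P -/-> Q with chains P -> A and B -> Q, which forbids A -> B
    ([reachable_or_obstructed]).  The order obtained is antisymmetric, so that
    distinct algebras of the list are not isomorphic, and the boundary of an
    orbit consists of everything strictly below it. *)

Set Implicit Arguments.
Unset Strict Implicit.
Unset Printing Implicit Defensive.

Import GRing.Theory Num.Theory.
Local Open Scope ring_scope.

(** * Orbits and their closures *)

Section OrbitClosure.
Variable K : fieldType.
Implicit Types (a b c d : structure K) (g h : 'M[K]_3) (x y : 'cV[K]_3).

Definition polynomial_function (f : structure K -> K) : Prop :=
  exists p : {mpoly K[#|{: 'I_3 * 'I_3 * 'I_3}|]},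
    forall c, f c = p.@[fun i => c (enum_val i)].

Lemma polynomial_const (u : K) : polynomial_function (fun=> u).
Proof. by exists u%:MP => c; rewrite mevalC. Qed.

Lemma polynomial_coord ijk : polynomial_function (fun c => c ijk).
Proof. by exists 'X_(enum_rank ijk) => c; rewrite mevalXU enum_rankK. Qed.

Lemma polynomialD f1 f2 : polynomial_function f1 -> polynomial_function f2 ->
  polynomial_function (fun c => f1 c + f2 c).
Proof. by move=> [p pE] [q qE]; exists (p + q) => c; rewrite mevalD pE qE. Qed.

Lemma polynomialM f1 f2 : polynomial_function f1 -> polynomial_function f2 ->
  polynomial_function (fun c => f1 c * f2 c).
Proof. by move=> [p pE] [q qE]; exists (p * q) => c; rewrite mevalM pE qE. Qed.

Lemma polynomialB f1 f2 : polynomial_function f1 -> polynomial_function f2 ->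
  polynomial_function (fun c => f1 c - f2 c).
Proof. by move=> [p pE] [q qE]; exists (p - q) => c; rewrite mevalB pE qE. Qed.

Lemma polynomialX f n : polynomial_function f ->
  polynomial_function (fun c => f c ^+ n).
Proof. by move=> [p pE]; exists (p ^+ n) => c; rewrite rmorphXn /= pE. Qed.

Lemma polynomial_sum (I : finType) (f : I -> structure K -> K) :
  (forall i, polynomial_function (f i)) ->
  polynomial_function (fun c => \sum_i f i c).
Proof.
move=> fP; rewrite /index_enum; elim: (Finite.enum I) => [|i r [p pE]].
  by exists 0 => c; rewrite big_nil meval0.
have [q qE] := fP i.
by exists (q + p) => c; rewrite big_cons mevalD pE qE.
Qed.

Lemma polynomial_mul (X Y : structure K -> 'cV[K]_3) :
  (forall i, polynomial_function (fun c => X c i 0)) ->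
  (forall i, polynomial_function (fun c => Y c i 0)) ->
  forall k : 'I_3, polynomial_function (fun c => mul c (X c) (Y c) k 0).
Proof.
move=> XP YP k.
have [p pE] : polynomial_function (fun c =>
    \sum_(i < 3) \sum_(j < 3) X c i 0 * Y c j 0 * c (i, j, k)).
  apply: polynomial_sum => i; apply: polynomial_sum => j.
  by apply: polynomialM (polynomial_coord _); apply: polynomialM.
by exists p => c; rewrite mulE pE.
Qed.

Lemma polynomial_act g ijk : polynomial_function (fun c => act g c ijk).
Proof.
have [p pE] : polynomial_function (fun c => \sum_l g ijk.2 l *
    mul c (invmx g *m basis_vec K ijk.1.1) (invmx g *m basis_vec K ijk.1.2)
      l 0).
  apply: polynomial_sum => l; apply: polynomialM (polynomial_const _) _.
  by apply: polynomial_mul => i; apply: polynomial_const.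
by exists p => c; rewrite ffunE mxE pE.
Qed.

Lemma polynomial_comp f (phi : structure K -> structure K) :
  polynomial_function f ->
  (forall ijk, polynomial_function (fun c => phi c ijk)) ->
  polynomial_function (fun c => f (phi c)).
Proof.
move=> [p pE] phiP.
pose N := #|{: 'I_3 * 'I_3 * 'I_3}|.
have [q qE] : exists q : 'I_N -> {mpoly K[N]},
    forall i c, phi c (enum_val i) = (q i).@[fun i => c (enum_val i)].
  exact: (fin_all_exists (fun i => phiP (enum_val i))).
exists (p \mPo [tuple q i | i < _]) => c; rewrite pE comp_mpoly_meval.
by apply: meval_eq => i; rewrite qE tnth_mktuple.
Qed.

(** The same closure in terms of functions instead of polynomials, so that
    membership in the ring of polynomial functions is all one has to check. *)
Lemma orbit_closureP a b : novikov b ->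
  (orbit_closure a b <->
   forall f, polynomial_function f -> (forall s, orbit a s -> f s = 0) ->
     f b = 0).
Proof.
move=> nb; split=> [[_ clb] f [p pE] f0 | clb].
  by rewrite pE; apply: clb => s /f0; rewrite pE.
split=> // p p0.
by apply: (clb (fun c => p.@[fun i => c (enum_val i)])) => //; exists p.
Qed.

Lemma mul_basis c i j k :
  mul c (basis_vec K i) (basis_vec K j) k 0 = c (i, j, k).
Proof.
rewrite mulE (bigD1 i) //= [X in _ + X]big1 => [|p npi]; last first.
  by rewrite big1 // => q _; rewrite !mxE (negPf npi) !mul0r.
rewrite addr0 (bigD1 j) //= big1 => [|q nqj]; last first.
  by rewrite !mxE (negPf nqj) mulr0 mul0r.
by rewrite !mxE !eqxx addr0 !mul1r.
Qed.

Lemma act1 c : act 1%:M c = c.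
Proof.
by apply/ffunP => -[[i j] k]; rewrite ffunE invmx1 !mul1mx mul_basis.
Qed.

Lemma act_comp g h c : g \in unitmx -> h \in unitmx ->
  act g (act h c) = act (g *m h) c.
Proof.
move=> gu hu; have ghu : g *m h \in unitmx by rewrite unitmx_mul gu.
have invM : invmx (g *m h) = invmx h *m invmx g.
  by apply: (can_inj (mulKmx ghu)); rewrite mulmxV // mulmxA mulmxK // mulmxV.
by apply/ffunP => p; rewrite !ffunE mul_act invM !mulmxA.
Qed.

Lemma orbit_refl c : orbit c c.
Proof. by exists 1%:M; rewrite ?unitmx1 ?act1. Qed.

Lemma orbit_sym c d : orbit c d -> orbit d c.
Proof.
move=> [g gu ->]; exists (invmx g); first by rewrite unitmx_inv.
by rewrite act_comp ?unitmx_inv // mulVmx // act1.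
Qed.

Lemma orbit_trans a b c : orbit a b -> orbit b c -> orbit a c.
Proof.
move=> [g gu ->] [h hu ->]; exists (h *m g); first by rewrite unitmx_mul hu.
by rewrite act_comp.
Qed.

Lemma orbit_novikov a b : novikov a -> orbit a b -> novikov b.
Proof. by move=> na [g gu ->]; apply: novikov_act. Qed.

Lemma orbit_sub_closure a b : novikov a -> orbit a b -> orbit_closure a b.
Proof.
by move=> na ab; split=> [|p]; [apply: orbit_novikov ab | apply].
Qed.

(** If [f] vanishes on the orbit of [a], then so does [f] composed with the
    action of any [g]; hence it vanishes at [b], that is, [f] vanishes on the
    whole orbit of [b]. *)
Lemma orbit_closure_trans a b c :
  orbit_closure a b -> orbit_closure b c -> orbit_closure a c.
Proof.
move=> clb clc; have [nb _] := clb; have [nc _] := clc.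
apply/(orbit_closureP _ nc) => f fP fa.
move/(orbit_closureP _ nc): clc; apply=> // _ [g gu ->].
move/(orbit_closureP _ nb): clb => /(_ (fun c => f (act g c))); apply.
  by apply: polynomial_comp => // ijk; apply: polynomial_act.
by move=> s as_; apply: fa; apply: orbit_trans as_ _; exists g.
Qed.

End OrbitClosure.

(** * Degenerations along polynomial curves *)

Section Degeneration.
Variable K : numFieldType.

(** The change of basis [invmx (E t)] carries [a] to the structure with
    constants [(D i j k).[t]] for every [t != 0].  Along this curve a polynomial
    vanishing on the orbit of [a] is a polynomial in [t] with infinitely many
    roots, so it is zero and vanishes at [t = 0] too. *)
Lemma orbit_closure_of_basis (a b : structure K) (E : K -> 'M[K]_3)
    (D : 'I_3 -> 'I_3 -> 'I_3 -> {poly K}) :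
  novikov b ->
  (forall t, t != 0 -> E t \in unitmx) ->
  (forall t i j, mul a (col i (E t)) (col j (E t)) =
     \sum_k (D i j k).[t] *: col k (E t)) ->
  (forall i j k, (D i j k).[0] = b (i, j, k)) ->
  orbit_closure a b.
Proof.
move=> nb Eu EP D0; split=> // p p0.
pose q := mmap polyC (fun i => let ijk := enum_val i in
  D ijk.1.1 ijk.1.2 ijk.2) p.
have qE t : q.[t] =
    p.@[fun i => let ijk := enum_val i in (D ijk.1.1 ijk.1.2 ijk.2).[t]].
  rewrite /q /mmap horner_sum mevalE; apply: eq_bigr => m _.
  rewrite hornerM hornerC; congr (_ * _); rewrite /mmap1 horner_prod.
  by apply: eq_bigr => i _; rewrite horner_exp.
have q_nz t : t != 0 -> q.[t] = 0.
  move=> /Eu u; rewrite qE -[RHS](p0 (act (invmx (E t)) a)); last first.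
    by exists (invmx (E t)); rewrite ?unitmx_inv.
  (* Column k of E t becomes the k-th basis vector under invmx (E t). *)
  apply: meval_eq => m; move: (enum_val m) => [[i j] k] /=.
  rewrite ffunE /= invmxK /basis_vec -!colE EP mulmx_sumr summxE.
  rewrite (bigD1 k) //= big1 => [|l nlk].
    by rewrite -scalemxAr colE mulKmx // !mxE !eqxx mulr1 addr0.
  by rewrite -scalemxAr colE mulKmx // !mxE eq_sym (negPf nlk) mulr0.
have q_eq0 : q = 0.
  apply: (@roots_geq_poly_eq0 _ _ [seq n.+1%:R | n <- iota 0 (size q)]).
  - by apply/allP => _ /mapP[n _ ->]; apply/rootP/q_nz; rewrite pnatr_eq0.
  - rewrite map_inj_uniq ?iota_uniq // => m n /eqP.
    by rewrite eqr_nat => /eqP[].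
  - by rewrite size_map size_iota.
rewrite -[RHS](horner0 0) -q_eq0 qE; apply: meval_eq => m /=.
by rewrite D0 -!surjective_pairing.
Qed.

End Degeneration.

(** * Coordinates in dimension three *)

Section Coordinates.
Variable K : fieldType.

Definition i0 : 'I_3 := ord0.
Definition i1 : 'I_3 := Ordinal (isT : 1 < 3)%N.
Definition i2 : 'I_3 := Ordinal (isT : 2 < 3)%N.

Lemma sum3 (V : nmodType) (F : 'I_3 -> V) : \sum_i F i = F i0 + (F i1 + F i2).
Proof.
rewrite !big_ord_recl big_ord0 addr0.
by congr (F _ + (F _ + F _)); apply: val_inj.
Qed.

Lemma ord3_ind (P : 'I_3 -> Prop) : P i0 -> P i1 -> P i2 -> forall i, P i.
Proof.
move=> P0 P1 P2 [[|[|[|//]]] lt3].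
- by rewrite (_ : Ordinal _ = i0) //; apply: val_inj.
- by rewrite (_ : Ordinal _ = i1) //; apply: val_inj.
- by rewrite (_ : Ordinal _ = i2) //; apply: val_inj.
Qed.

Lemma det3 (A : 'M[K]_3) : \det A =
  A i0 i0 * (A i1 i1 * A i2 i2 - A i1 i2 * A i2 i1)
  - A i0 i1 * (A i1 i0 * A i2 i2 - A i1 i2 * A i2 i0)
  + A i0 i2 * (A i1 i0 * A i2 i1 - A i1 i1 * A i2 i0).
Proof.
rewrite (expand_det_row _ i0) sum3 /cofactor !(expand_det_row _ ord0).
rewrite !big_ord_recl !big_ord0 /cofactor !det_mx11 !mxE.
have -> : lift (lift ord0 ord0) 0 = 0 :> 'I_2 by apply: val_inj.
have -> : lift i0 0 = i1 by apply: val_inj.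
have -> : lift i0 (lift ord0 0) = i2 by apply: val_inj.
have -> : lift i1 (0 : 'I_2) = i0 by apply: val_inj.
have -> : lift i1 (lift ord0 0) = i2 by apply: val_inj.
have -> : lift i2 (0 : 'I_2) = i0 by apply: val_inj.
have -> : lift i2 (lift ord0 0) = i1 by apply: val_inj.
rewrite /= /bump /=; ring.
Qed.

(** The test that decides a structure constant of the [n]-th algebra, with
    indices starting at 0, in a form that reduces on numerals. *)
Definition listed (n i j k : nat) : bool :=
  has (fun p => [&& eqn i.+1 p.1.1, eqn j.+1 p.1.2 & eqn k.+1 p.2])
    (products n).

Lemma algAE n (i j k : 'I_3) : algA K n (i, j, k) = (listed n i j k)%:R.
Proof.
rewrite ffunE; congr (nat_of_bool _)%:R; apply/idP/hasP => [ijk | [p ps]].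
  by exists (i.+1, j.+1, k.+1)%N; rewrite //= !eqnE !eqxx.
by rewrite !eqnE => /and3P[/eqP-> /eqP-> /eqP->]; case: p ps => [[]].
Qed.

Lemma mul_algA n (x y : 'cV[K]_3) (k : 'I_3) : mul (algA K n) x y k 0 =
  \sum_i \sum_j x i 0 * y j 0 * (listed n i j k)%:R.
Proof.
by rewrite mulE; do 2!(apply: eq_bigr => ? _); rewrite algAE.
Qed.

End Coordinates.

(** * The seventeen degenerations *)

Section Edges.
Variable K : numFieldType.

(** Coordinate [p] of the [i]-th of three vectors listed by their entries; the
    default value lets trailing zeros be omitted. *)
Definition coordinates (v1 v2 v3 : seq K) (i p : 'I_3) : K :=
  nth 0 (nth [::] [:: v1; v2; v3] i) p.

(** [orbit_closure_of_basis] for the algebras of the list.  The structure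
    constants in the basis [v t] are written as those of the limit plus [t]
    times a remainder [r i j], indexed from 1, so that the limit at [t = 0] is
    automatic; by commutativity only the pairs [i <= j] matter. *)
Lemma algA_degeneration n m (v1 v2 v3 : K -> seq K)
    (r : nat -> nat -> seq {poly K}) (u : K) (d : nat) :
  let v t := coordinates (v1 t) (v2 t) (v3 t) in
  u != 0 ->
  (forall t, \det (\matrix_(p, i) v t i p) = u * t ^+ d) ->
  (forall t (i j k : 'I_3), (i <= j)%N ->
     \sum_(p < 3) \sum_(q < 3) v t i p * v t j q * (listed n p q k)%:R =
     \sum_(l < 3)
       ((listed m i j l)%:R + t * (nth 0 (r i.+1 j.+1) l).[t]) * v t l k) ->
  orbit_closure (algA K n) (algA K m).
Proof.
move=> v u0 detE EP.
pose E t := \matrix_(p, i) v t i p.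
pose D (i j k : 'I_3) : {poly K} := (algA K m (i, j, k))%:P +
  'X * (r (minn i j).+1 (maxn i j).+1)`_k.
apply: (@orbit_closure_of_basis _ _ _ E D (algA_novikov K m)).
- by move=> t t0; rewrite unitmxE unitfE detE mulf_neq0 ?expf_neq0.
- move=> t i j.
  wlog ij : i j / (i <= j)%N => [sym|].
    case: (leqP i j) => [/sym // | /ltnW/sym]; rewrite algA_comm => ->.
    apply: eq_bigr => k _; congr (_.[t] *: _).
    rewrite /D minnC maxnC; congr (_%:P + _).
    by rewrite -!mul_basis algA_comm.
  apply/colP => k; rewrite mul_algA summxE.
  under eq_bigr => p _ do under eq_bigr => q _ do rewrite !mxE.
  rewrite EP //; apply: eq_bigr => l _.
  by rewrite !mxE /D !hornerE algAE (minn_idPl ij) (maxn_idPr ij).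
- by move=> i j k; rewrite /D !hornerE.
Qed.

Ltac degeneration_by v1 v2 v3 r u d :=
  apply: (@algA_degeneration _ _ v1 v2 v3 r u d);
  [> by rewrite ?oppr_eq0 ?oner_neq0 ?pnatr_eq0
   | by move=> t; rewrite det3 !mxE /coordinates /=; ring
   | by move=> t; do 2!elim/ord3_ind => //; elim/ord3_ind => // _;
     rewrite !sum3 /coordinates /=;
     rewrite ?(hornerM, hornerN, hornerXn, hornerX, hornerC, horner0);
     ring].

(** Rescaling an idempotent [e] to [t e] makes its square [t (t e)] tend
    to 0. *)
Lemma degeneration_4_3 : orbit_closure (algA K 4) (algA K 3).
Proof.
degeneration_by (fun t : K => [:: t; 0; 0] : seq K)
  (fun t : K => [:: 0; 1; 0] : seq K)
  (fun t : K => [:: 0; 0; 1] : seq K)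
  (fun i j => match i, j return seq {poly K} with
     | 1, 1 => ([:: 1])%R
     | _, _ => [::]
     end%N) (1 : K) 1%N.
Qed.

Lemma degeneration_8_7 : orbit_closure (algA K 8) (algA K 7).
Proof.
degeneration_by (fun t : K => [:: 1; 0; 0] : seq K)
  (fun t : K => [:: 0; 1; 0] : seq K)
  (fun t : K => [:: 0; 0; t] : seq K)
  (fun i j => match i, j return seq {poly K} with
     | 3, 3 => ([:: 0; 0; 1])%R
     | _, _ => [::]
     end%N) (1 : K) 1%N.
Qed.

(** Rescaling a nilpotent factor of a product makes the product tend to 0. *)
Lemma degeneration_6_2 : orbit_closure (algA K 6) (algA K 2).
Proof.
degeneration_by (fun t : K => [:: 1; 0; 0] : seq K)
  (fun t : K => [:: 0; t; 0] : seq K)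
  (fun t : K => [:: 0; 0; 1] : seq K)
  (fun i j => match i, j return seq {poly K} with
     | 2, 2 => ([:: 'X])%R
     | _, _ => [::]
     end%N) (1 : K) 1%N.
Qed.

Lemma degeneration_5_1 : orbit_closure (algA K 5) (algA K 1).
Proof.
degeneration_by (fun t : K => [:: 1; 0; 0] : seq K)
  (fun t : K => [:: 0; t; 0] : seq K)
  (fun t : K => [:: 0; 0; 1] : seq K)
  (fun i j => match i, j return seq {poly K} with
     | 2, 2 => ([:: 'X])%R
     | _, _ => [::]
     end%N) (1 : K) 1%N.
Qed.

(** Shrinking [e_3] removes its square; [e_1] shrinks along with it to keep
    [e_2 e_3 = e_1]. *)
Lemma degeneration_10_9 : orbit_closure (algA K 10) (algA K 9).
Proof.
degeneration_by (fun t : K => [:: t; 0; 0] : seq K)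
  (fun t : K => [:: 0; 1; 0] : seq K)
  (fun t : K => [:: 0; 0; t] : seq K)
  (fun i j => match i, j return seq {poly K} with
     | 3, 3 => ([:: 0; 'X])%R
     | _, _ => [::]
     end%N) (1 : K) 2%N.
Qed.

Lemma degeneration_12_11 : orbit_closure (algA K 12) (algA K 11).
Proof.
degeneration_by (fun t : K => [:: 1; 0; 0] : seq K)
  (fun t : K => [:: 0; t; 0] : seq K)
  (fun t : K => [:: 0; 0; 1] : seq K)
  (fun i j => match i, j return seq {poly K} with
     | 2, 2 => ([:: 'X])%R
     | _, _ => [::]
     end%N) (1 : K) 1%N.
Qed.

(** Two idempotents with sum [u] merge: the span of [u] and [x = t e], with
    [x^2 = t x], is C[x]/(x(x - t)) and tends to C[x]/(x^2). *)
Lemma degeneration_4_8 : orbit_closure (algA K 4) (algA K 8).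
Proof.
degeneration_by (fun t : K => [:: t; 0; 0] : seq K)
  (fun t : K => [:: 1; 1; 0] : seq K)
  (fun t : K => [:: 0; 0; 1] : seq K)
  (fun i j => match i, j return seq {poly K} with
     | 1, 1 => ([:: 1])%R
     | _, _ => [::]
     end%N) (1 : K) 1%N.
Qed.

Lemma degeneration_3_7 : orbit_closure (algA K 3) (algA K 7).
Proof.
degeneration_by (fun t : K => [:: 0; t; 0] : seq K)
  (fun t : K => [:: 0; 1; 1] : seq K)
  (fun t : K => [:: 1; 0; 0] : seq K)
  (fun i j => match i, j return seq {poly K} with
     | 1, 1 => ([:: 1])%R
     | _, _ => [::]
     end%N) (1 : K) 1%N.
Qed.

(** Here [x = e_1 + t e_2] satisfies [x^3 = t x^2]: the ideal (x) of
    C[x]/(x^2(x - t)) tends to that of C[x]/(x^3). *)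
Lemma degeneration_3_6 : orbit_closure (algA K 3) (algA K 6).
Proof.
degeneration_by (fun t : K => [:: 0; t ^+ 2; 0] : seq K)
  (fun t : K => [:: 1; t; 0] : seq K)
  (fun t : K => [:: 0; 0; 1] : seq K)
  (fun i j => match i, j return seq {poly K} with
     | 1, 1 => ([:: 'X])%R
     | 1, 2 => ([:: 1])%R
     | _, _ => [::]
     end%N) ((-1) : K) 2%N.
Qed.

(** Here [x = e_1 + t e_2] generates the ideal (x) of C[x]/(x(x - t)^2). *)
Lemma degeneration_8_6 : orbit_closure (algA K 8) (algA K 6).
Proof.
degeneration_by (fun t : K => [:: 2 * t; t ^+ 2; 0] : seq K)
  (fun t : K => [:: 1; t; 0] : seq K)
  (fun t : K => [:: 0; 0; 1] : seq K)
  (fun i j => match i, j return seq {poly K} with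
     | 1, 1 => ([:: 3%:P * 'X; - 2%:P * 'X^2])%R
     | 1, 2 => ([:: 2%:P; - 'X])%R
     | _, _ => [::]
     end%N) (1 : K) 2%N.
Qed.

(** The unital algebra C[x]/(x^2(x - t)), with [x = e_1 + t e_3], tends to
    C[x]/(x^3); its unit is [e_2 + e_3]. *)
Lemma degeneration_8_12 : orbit_closure (algA K 8) (algA K 12).
Proof.
degeneration_by (fun t : K => [:: 0; 0; t ^+ 2] : seq K)
  (fun t : K => [:: 1; 0; t] : seq K)
  (fun t : K => [:: 0; 1; 1] : seq K)
  (fun i j => match i, j return seq {poly K} with
     | 1, 1 => ([:: 'X])%R
     | 1, 2 => ([:: 1])%R
     | _, _ => [::]
     end%N) (1 : K) 2%N.
Qed.

(** The vector [e_2 + e_3] has square [2 e_1], and shrinking [e_3] removes the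
    other products. *)
Lemma degeneration_9_5 : orbit_closure (algA K 9) (algA K 5).
Proof.
degeneration_by (fun t : K => [:: 2; 0; 0] : seq K)
  (fun t : K => [:: 0; 1; 1] : seq K)
  (fun t : K => [:: 0; 0; 2 * t] : seq K)
  (fun i j => match i, j return seq {poly K} with
     | 2, 3 => ([:: 1])%R
     | _, _ => [::]
     end%N) (4 : K) 1%N.
Qed.

(** The same polynomial [x^2(x - t)] as for the degeneration of [algA 3] to
    [algA 6], now with [x = e_1 + t e_3]. *)
Lemma degeneration_2_5 : orbit_closure (algA K 2) (algA K 5).
Proof.
degeneration_by (fun t : K => [:: 0; 0; t ^+ 2] : seq K)
  (fun t : K => [:: 1; 0; t] : seq K)
  (fun t : K => [:: 0; 1; 0] : seq K)
  (fun i j => match i, j return seq {poly K} with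
     | 1, 1 => ([:: 'X])%R
     | 1, 2 => ([:: 1])%R
     | _, _ => [::]
     end%N) (1 : K) 2%N.
Qed.

(** The vector [x = e_1 + t e_3] satisfies [x (x - t)^2 = 0], and [t] is the
    scalar by which it multiplies the remaining basis vector [e_2]. *)
Lemma degeneration_11_5 : orbit_closure (algA K 11) (algA K 5).
Proof.
degeneration_by (fun t : K => [:: 2 * t; 0; t ^+ 2] : seq K)
  (fun t : K => [:: 1; 0; t] : seq K)
  (fun t : K => [:: 0; 1; 0] : seq K)
  (fun i j => match i, j return seq {poly K} with
     | 1, 1 => ([:: 3%:P * 'X; - 2%:P * 'X^2])%R
     | 1, 2 => ([:: 2%:P; - 'X])%R
     | 1, 3 => ([:: 0; 0; 'X])%R
     | 2, 3 => ([:: 0; 0; 1])%R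
     | _, _ => [::]
     end%N) ((-1) : K) 2%N.
Qed.

(** The ideal (x) of C[x]/(x^3(x - t)), with [x = e_2 + t e_3]; in this and the
    two degenerations that follow, the basis is [x^3], [x^2], [x]. *)
Lemma degeneration_6_10 : orbit_closure (algA K 6) (algA K 10).
Proof.
degeneration_by (fun t : K => [:: 0; 0; t ^+ 3] : seq K)
  (fun t : K => [:: 1; 0; t ^+ 2] : seq K)
  (fun t : K => [:: 0; 1; t] : seq K)
  (fun i j => match i, j return seq {poly K} with
     | 1, 1 => ([:: 'X^2])%R
     | 1, 2 => ([:: 'X])%R
     | 1, 3 | 2, 2 => ([:: 1])%R
     | _, _ => [::]
     end%N) (1 : K) 3%N.
Qed.

(** The ideal (x) of C[x]/(x^2(x - t)^2), with [x = e_1 + t e_2 + e_3]: the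
    double root [t] comes from [e_1 + t e_2], the double root 0 from [e_3]. *)
Lemma degeneration_7_10 : orbit_closure (algA K 7) (algA K 10).
Proof.
degeneration_by (fun t : K => [:: 3 * t ^+ 2; t ^+ 3; 0] : seq K)
  (fun t : K => [:: 2 * t; t ^+ 2; 0] : seq K)
  (fun t : K => [:: 1; t; 1] : seq K)
  (fun i j => match i, j return seq {poly K} with
     | 1, 1 => ([:: 4%:P * 'X^2; - 3%:P * 'X^3])%R
     | 1, 2 => ([:: 3%:P * 'X; - 2%:P * 'X^2])%R
     | 1, 3 | 2, 2 => ([:: 2%:P; - 'X])%R
     | _, _ => [::]
     end%N) (1 : K) 4%N.
Qed.

(** The ideal (x) of C[x]/(x(x - t)^3), with [x = e_2 + t e_3]; it is all of
    [algA 12] because [x] is invertible there for [t <> 0]. *)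
Lemma degeneration_12_10 : orbit_closure (algA K 12) (algA K 10).
Proof.
degeneration_by (fun t : K => [:: 3 * t; 3 * t ^+ 2; t ^+ 3] : seq K)
  (fun t : K => [:: 1; 2 * t; t ^+ 2] : seq K)
  (fun t : K => [:: 0; 1; t] : seq K)
  (fun i j => match i, j return seq {poly K} with
     | 1, 1 => ([:: 10%:P * 'X^2; - 15%:P * 'X^3; 6%:P * 'X^4])%R
     | 1, 2 => ([:: 6%:P * 'X; - 8%:P * 'X^2; 3%:P * 'X^3])%R
     | 1, 3 | 2, 2 => ([:: 3%:P; - 3%:P * 'X; 'X^2])%R
     | _, _ => [::]
     end%N) (1 : K) 3%N.
Qed.

End Edges.

(** * Covariants as obstructions *)

Section Covariants.
Variable K : fieldType.
Implicit Types (c : structure K) (phi : 'rV[K]_3) (x y z : 'cV[K]_3).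

Definition left_mul c x : 'M[K]_3 :=
  \matrix_(k, j) mul c x (basis_vec K j) k 0.

Definition trace c x : K := \tr (left_mul c x).

Definition pairing phi x : K := (phi *m x) 0 0.

Lemma left_mulP c x y : left_mul c x *m y = mul c x y.
Proof.
apply/colP => k; rewrite mulE mxE exchange_big /=; apply: eq_bigr => j _.
rewrite !mxE mulE mulr_suml; apply: eq_bigr => i _.
rewrite (bigD1 j) //= big1 => [|l nlj]; last first.
  by rewrite !mxE (negPf nlj) mulr0 mul0r.
by rewrite !mxE !eqxx mulr1 addr0 mulrAC.
Qed.

Lemma mul_act_mulmx g c x y : g \in unitmx ->
  mul (act g c) (g *m x) (g *m y) = g *m mul c x y.
Proof. by move=> gu; rewrite mul_act !mulKmx. Qed.

(** Left multiplication by [g x] in the transported structure is the conjugate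
    by [g] of left multiplication by [x]. *)
Lemma trace_act_mulmx g c x : g \in unitmx ->
  trace (act g c) (g *m x) = trace c x.
Proof.
move=> gu; rewrite /trace -[left_mul c _ in RHS](mulKmx gu) mxtrace_mulC.
congr (\tr _); apply/matrixP => k j; rewrite mxE mul_act mulKmx //.
by rewrite -left_mulP !mulmxA /basis_vec -colE mxE.
Qed.

Lemma pairing_mulmx g phi x : pairing phi (g *m x) = pairing (phi *m g) x.
Proof. by rewrite /pairing mulmxA. Qed.

Lemma polynomial_trace (X : structure K -> 'cV[K]_3) :
  (forall i, polynomial_function (fun c => X c i 0)) ->
  polynomial_function (fun c => trace c (X c)).
Proof.
move=> XP.
have [p pE] : polynomial_function (fun c =>
    \sum_j mul c (X c) (basis_vec K j) j 0).
  apply: polynomial_sum => j.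
  by apply: polynomial_mul => // i; apply: polynomial_const.
by exists p => c; rewrite -pE; apply: eq_bigr => j _; rewrite mxE.
Qed.

Lemma polynomial_pairing phi (X : structure K -> 'cV[K]_3) :
  (forall i, polynomial_function (fun c => X c i 0)) ->
  polynomial_function (fun c => pairing phi (X c)).
Proof.
move=> XP.
have [p pE] : polynomial_function (fun c => \sum_k phi 0 k * X c k 0).
  by apply: polynomial_sum => k; apply: polynomialM (polynomial_const _) _.
by exists p => c; rewrite -pE /pairing mxE.
Qed.

(** The linear form [phi] turns vector identities into scalar ones, so that one
    type of functions serves for all obstructions. *)
Definition covariant
    (f : structure K -> 'rV[K]_3 -> 'cV[K]_3 -> 'cV[K]_3 -> 'cV[K]_3 -> K) :=
  (forall phi x y z, polynomial_function (fun c => f c phi x y z)) /\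
  (forall g c phi x y z, g \in unitmx ->
     f (act g c) phi (g *m x) (g *m y) (g *m z) = f c (phi *m g) x y z).

(** Equivariance extends the identity [f = 0] from [a] to its orbit, and
    polynomiality extends it to the closure. *)
Lemma covariant_obstruction f a b phi x y z : covariant f ->
  (forall phi x y z, f a phi x y z = 0) -> f b phi x y z != 0 ->
  ~ orbit_closure a b.
Proof.
move=> [fP fE] fa fb [_ clb]; have [p pE] := fP phi x y z.
case/negP: fb; rewrite pE clb // => _ [g gu ->].
by rewrite -pE -(mulKVmx gu x) -(mulKVmx gu y) -(mulKVmx gu z) fE // fa.
Qed.

End Covariants.

Ltac prove_covariant :=
  split=> [phi x y z | g c phi x y z gu];
  [ repeat first
    [ apply: polynomial_const | apply: polynomialB | apply: polynomialD
    | apply: polynomialM | apply: polynomialX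
    | apply: polynomial_trace => ? | apply: polynomial_pairing => ?
    | apply: polynomial_mul => ? ]
  | by rewrite ?mul_act_mulmx ?trace_act_mulmx // ?pairing_mulmx].

(** * The ten obstructions *)

Section Obstructions.
Variable K : numFieldType.
Implicit Types (c : structure K) (phi : 'rV[K]_3) (x y z : 'cV[K]_3).

Definition product c phi x y z := pairing phi (mul c x y).

Lemma product_covariant : covariant product.
Proof. by rewrite /product; prove_covariant. Qed.

Definition triple_product c phi x y z := pairing phi (mul c (mul c x y) z).

Lemma triple_product_covariant : covariant triple_product.
Proof. by rewrite /triple_product; prove_covariant. Qed.

(** If a commutative associative algebra is the product of a nilpotent one and
    a local unital one of dimension [n], then left multiplication by [x] has a
    single possibly nonzero eigenvalue, [lambda x] with multiplicity [n], for a
    character [lambda]; the trace is [n lambda], and this expression vanishes.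
    This is so for [algA 6], [algA 7] and [algA 12], with [n] equal to 1, 2
    and 3. *)
Definition trace_defect (n : nat) c phi x y z :=
  n%:R * trace c (mul c x y) - trace c x * trace c y.

Lemma trace_defect_covariant n : covariant (trace_defect n).
Proof. by rewrite /trace_defect; prove_covariant. Qed.

(** At [x = y], [trace_defect 3] is the sum of the squared differences of the
    three eigenvalues of left multiplication by [x].  In [algA 8] two of them
    always coincide, so this quadratic form is the square of a linear form up to
    a factor and its Gram determinants vanish. *)
Definition trace_gram c phi x y z :=
  trace_defect 3 c phi x y z ^+ 2 -
  trace_defect 3 c phi x x z * trace_defect 3 c phi y y z.

Lemma trace_gram_covariant : covariant trace_gram.
Proof. by rewrite /trace_gram /trace_defect; prove_covariant. Qed.

(** By the Newton identities this is six times the determinant of left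
    multiplication by [x]; it vanishes identically on an algebra with a nonzero
    annihilator such as [algA 3], but not at the unit of [algA 11]. *)
Definition triple_det c phi x y z :=
  trace c x ^+ 3 - 3 * trace c x * trace c (mul c x x) +
  2 * trace c (mul c (mul c x x) x).

Lemma triple_det_covariant : covariant triple_det.
Proof. by rewrite /triple_det; prove_covariant. Qed.

(** In [algA 2] the product is a rank one form: [x y = lambda x lambda y e_3].
    In [algA 11], where the trace is [3 lambda] and
    [(x - lambda x e_3) (y - lambda y e_3) = 0], the combination with [s = 1]
    equals [- 3 lambda x lambda y e_3].  In both cases the Gram determinants of
    the form vanish.  In [algA 9] the trace is 0 and the product is a form of
    rank two, so neither value of [s] makes them vanish. *)
Definition shifted_product (s : K) c phi x y :=
  3 * pairing phi (mul c x y) -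
  s * (trace c x * pairing phi y + trace c y * pairing phi x).

Definition product_gram s c phi x y z :=
  shifted_product s c phi x y ^+ 2 -
  shifted_product s c phi x x * shifted_product s c phi y y.

Lemma product_gram_covariant s : covariant (product_gram s).
Proof. by rewrite /product_gram /shifted_product; prove_covariant. Qed.

Lemma trace_algA n x :
  trace (algA K n) x = \sum_(i < 3) \sum_(j < 3) x i 0 * (listed n i j j)%:R.
Proof.
rewrite /trace /mxtrace exchange_big; apply: eq_bigr => j _.
rewrite mxE mulE; apply: eq_bigr => i _.
rewrite (bigD1 j) //= big1 => [|l nlj]; last first.
  by rewrite !mxE (negPf nlj) mulr0 mul0r.
by rewrite !mxE !eqxx mulr1 addr0 algAE.
Qed.

Lemma eq_neq (u v : K) : u = v -> v != 0 -> u != 0.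
Proof. by move=> ->. Qed.

(* The value [u] at the [a]-th coordinate form and the [i]-th and [j]-th basis
   vectors witnesses the violation.  Products nest at most twice, hence the two
   rounds of expansion. *)
Ltac obstruction f_covariant a i j u :=
  apply: (covariant_obstruction (phi := delta_mx 0 a) (x := basis_vec K i)
    (y := basis_vec K j) (z := basis_vec K j) f_covariant);
  [ move=> phi x y z
  | apply: (@eq_neq _ (u : K));
    last by rewrite ?oppr_eq0 ?oner_eq0 ?pnatr_eq0 ];
  rewrite /product /triple_product /trace_gram /trace_defect /triple_det
    /product_gram /shifted_product /pairing ?mxE ?trace_algA ?sum3
    ?mul_algA ?sum3 ?mul_algA ?sum3 ?mxE /=; ring.

Lemma no_degeneration_1_5 : ~ orbit_closure (algA K 1) (algA K 5).
Proof. obstruction product_covariant i0 i1 i1 (1 : K). Qed.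

Lemma no_degeneration_9_10 : ~ orbit_closure (algA K 9) (algA K 10).
Proof. obstruction triple_product_covariant i0 i2 i2 (1 : K). Qed.

Lemma no_degeneration_6_7 : ~ orbit_closure (algA K 6) (algA K 7).
Proof. obstruction (trace_defect_covariant 1) i0 i1 i1 (- 2 : K). Qed.

Lemma no_degeneration_7_2 : ~ orbit_closure (algA K 7) (algA K 2).
Proof. obstruction (trace_defect_covariant 2) i0 i2 i2 (1 : K). Qed.

Lemma no_degeneration_12_2 : ~ orbit_closure (algA K 12) (algA K 2).
Proof. obstruction (trace_defect_covariant 3) i0 i2 i2 (2 : K). Qed.

Lemma no_degeneration_12_7 : ~ orbit_closure (algA K 12) (algA K 7).
Proof. obstruction (trace_defect_covariant 3) i0 i1 i1 (2 : K). Qed.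

Lemma no_degeneration_8_3 : ~ orbit_closure (algA K 8) (algA K 3).
Proof. obstruction trace_gram_covariant i0 i1 i2 (- 3 : K). Qed.

Lemma no_degeneration_3_11 : ~ orbit_closure (algA K 3) (algA K 11).
Proof. obstruction triple_det_covariant i0 i2 i2 (6 : K). Qed.

Lemma no_degeneration_2_9 : ~ orbit_closure (algA K 2) (algA K 9).
Proof. obstruction (product_gram_covariant 0) i0 i1 i2 (9 : K). Qed.

Lemma no_degeneration_11_9 : ~ orbit_closure (algA K 11) (algA K 9).
Proof. obstruction (product_gram_covariant 1) i0 i1 i2 (9 : K). Qed.

End Obstructions.

(** * The order on the twelve algebras *)

Section Classification.
Variable K : numFieldType.

Definition degenerations : seq (nat * nat) :=
  [:: (4, 3); (4, 8); (3, 6); (3, 7); (8, 6); (8, 7); (8, 12); (6, 2); (6, 10);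
      (7, 10); (12, 10); (12, 11); (10, 9); (9, 5); (2, 5); (11, 5); (5, 1)]%N.

Definition obstructions : seq (nat * nat) :=
  [:: (1, 5); (9, 10); (6, 7); (7, 2); (12, 2); (12, 7); (8, 3); (3, 11);
      (2, 9); (11, 9)]%N.

(** Existence of a chain of at most [n] degenerations.  Filtering before the
    recursive call keeps evaluation by value from exploring all chains. *)
Fixpoint reachable (n i j : nat) : bool :=
  (i == j) || (if n is n'.+1 then
    has (fun e => reachable n' e.2 j) [seq e <- degenerations | e.1 == i]
  else false).

Lemma reachableS n i j : reachable n.+1 i j =
  (i == j) || has (fun e => reachable n e.2 j)
    [seq e <- degenerations | e.1 == i].
Proof. by []. Qed.

Lemma degenerationP e : e \in degenerations ->
  orbit_closure (algA K e.1) (algA K e.2).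
Proof.
rewrite in_cons => /predU1P[-> | ]; first exact: degeneration_4_3.
rewrite in_cons => /predU1P[-> | ]; first exact: degeneration_4_8.
rewrite in_cons => /predU1P[-> | ]; first exact: degeneration_3_6.
rewrite in_cons => /predU1P[-> | ]; first exact: degeneration_3_7.
rewrite in_cons => /predU1P[-> | ]; first exact: degeneration_8_6.
rewrite in_cons => /predU1P[-> | ]; first exact: degeneration_8_7.
rewrite in_cons => /predU1P[-> | ]; first exact: degeneration_8_12.
rewrite in_cons => /predU1P[-> | ]; first exact: degeneration_6_2.
rewrite in_cons => /predU1P[-> | ]; first exact: degeneration_6_10.
rewrite in_cons => /predU1P[-> | ]; first exact: degeneration_7_10.
rewrite in_cons => /predU1P[-> | ]; first exact: degeneration_12_10.
rewrite in_cons => /predU1P[-> | ]; first exact: degeneration_12_11.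
rewrite in_cons => /predU1P[-> | ]; first exact: degeneration_10_9.
rewrite in_cons => /predU1P[-> | ]; first exact: degeneration_9_5.
rewrite in_cons => /predU1P[-> | ]; first exact: degeneration_2_5.
rewrite in_cons => /predU1P[-> | ]; first exact: degeneration_11_5.
rewrite in_cons => /predU1P[-> | ]; first exact: degeneration_5_1.
by rewrite in_nil.
Qed.

Lemma obstructionP e : e \in obstructions ->
  ~ orbit_closure (algA K e.1) (algA K e.2).
Proof.
rewrite in_cons => /predU1P[-> | ]; first exact: no_degeneration_1_5.
rewrite in_cons => /predU1P[-> | ]; first exact: no_degeneration_9_10.
rewrite in_cons => /predU1P[-> | ]; first exact: no_degeneration_6_7.
rewrite in_cons => /predU1P[-> | ]; first exact: no_degeneration_7_2.
rewrite in_cons => /predU1P[-> | ]; first exact: no_degeneration_12_2.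
rewrite in_cons => /predU1P[-> | ]; first exact: no_degeneration_12_7.
rewrite in_cons => /predU1P[-> | ]; first exact: no_degeneration_8_3.
rewrite in_cons => /predU1P[-> | ]; first exact: no_degeneration_3_11.
rewrite in_cons => /predU1P[-> | ]; first exact: no_degeneration_2_9.
rewrite in_cons => /predU1P[-> | ]; first exact: no_degeneration_11_9.
by rewrite in_nil.
Qed.

Lemma reachable_closure n i j :
  reachable n i j -> orbit_closure (algA K i) (algA K j).
Proof.
have refl k : orbit_closure (algA K k) (algA K k).
  by apply: orbit_sub_closure (algA_novikov K k) (orbit_refl _).
elim: n i => [|n IHn] i; first by rewrite /= orbF => /eqP->.
rewrite reachableS; case/orP => [/eqP-> // | /hasP[e]].
rewrite mem_filter => /andP[/eqP <- /degenerationP ed] /IHn.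
by apply: orbit_closure_trans.
Qed.

(** Six is the length of the longest chain, for instance
    4 -> 8 -> 12 -> 10 -> 9 -> 5 -> 1. *)
Lemma reachable_boundary_list : {in iota 1 12 &, forall i j,
  reachable 6 i j = (j \in i :: boundary_list i)}.
Proof.
suff /allrelP H : allrel
    (fun i j => reachable 6 i j == (j \in i :: boundary_list i))
    (iota 1 12) (iota 1 12).
  by move=> i j i12 j12; apply/eqP/H.
by vm_compute.
Qed.

Lemma reachable_or_obstructed : {in iota 1 12 &, forall i j,
  reachable 6 i j ||
  has (fun e => reachable 6 e.1 i && reachable 6 j e.2) obstructions}.
Proof. by apply/allrelP; vm_compute. Qed.

(** This separates the isomorphism classes: an algebra isomorphic to [algA i]
    has [algA i] in its orbit closure. *)
Lemma boundary_list_antisym : {in iota 1 12 &, forall i j,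
  j \in boundary_list i -> i \notin j :: boundary_list j}.
Proof.
suff /allrelP H : allrel
    (fun i j => (j \in boundary_list i) ==> (i \notin j :: boundary_list j))
    (iota 1 12) (iota 1 12).
  by move=> i j i12 j12; apply/implyP/H.
by vm_compute.
Qed.

Lemma orbit_closure_algA i j : i \in iota 1 12 -> j \in iota 1 12 ->
  (orbit_closure (algA K i) (algA K j) <-> j \in i :: boundary_list i).
Proof.
move=> i12 j12; rewrite -reachable_boundary_list //.
split=> [clij | /reachable_closure //].
have /orP[// | /hasP[e /obstructionP ne /andP[ei je]]] :=
  reachable_or_obstructed i12 j12.
case: ne; apply: orbit_closure_trans (reachable_closure je).
by apply: orbit_closure_trans (reachable_closure ei) clij.
Qed.

Lemma lies_in_boundary_algA i j : i \in iota 1 12 -> j \in iota 1 12 ->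
  (lies_in_boundary (algA K j) (algA K i) <-> j \in boundary_list i).
Proof.
move=> i12 j12; split=> [[d jd [[nd cl_d] nid]] | ji].
  have /(orbit_closure_algA i12 j12) : orbit_closure (algA K i) (algA K j).
    by apply: (orbit_closure_trans (conj nd cl_d)) (orbit_sub_closure nd _);
      apply: orbit_sym.
  by rewrite in_cons => /predU1P[jEi | //]; case: nid; rewrite -jEi.
exists (algA K j); first exact: orbit_refl.
split; first by apply/orbit_closure_algA => //; rewrite in_cons ji orbT.
move=> ij; have /negP := boundary_list_antisym i12 j12 ji; apply.
apply/orbit_closure_algA => //.
by apply: orbit_sub_closure (algA_novikov K j) (orbit_sym ij).
Qed.

End Classification.

Theorem proposition4p1 (R : realType) (i j : nat)
    (hi : (1 <= i <= 12)%N) (hj : (1 <= j <= 12)%N) :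
  lies_in_boundary (algA R[i] j) (algA R[i] i) <-> j \in boundary_list i.
Proof. by apply: (@lies_in_boundary_algA R[i]); rewrite mem_iota. Qed.
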